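(* If $\psi$ is an $L$-formula with $n$ free variables, $M\in\mathrm{pSh}(\Omega,L)$ and $\bar a\in{}^n|M|$, then $[\psi(\bar a)]_M=[\psi^\exists(\bar a)]_M$.
   Context: **Presheaves.** Fix a complete Heyting algebra $\Omega$ (bottom $\bot$, top $\top$). A presheaf $M$ over $\Omega$ is a set $|M|$ of sections with maps $E:|M|\to\Omega$ (extent) and $\upharpoonright:|M|\times\Omega\to|M|$ (restriction) such that $a\upharpoonright Ea=a$, $E(a\upharpoonright p)=Ea\wedge p$, $(a\upharpoonright p)\upharpoonright q=a\upharpoonright(p\wedge q)$. Put $[a=b]_M=\bigvee\{p\le Ea\wedge Eb: a\upharpoonright p=b\upharpoonright p\}$; presheaves are extensional: $Ea=Eb=[a=b]_M$ implies $a=b$. For a tuple $\bar a$ of sections, $E\bar a=\bigwedge_iEa_i$ ($E\emptyset=\top$), $\bar a\upharpoonright p=\langle a_i\upharpoonright p\rangle_i$, $[\bar a=\bar b]_M=\bigwedge_i[a_i=b_i]_M$. **Structures.** A signature has finitary relation symbols, finitary function symbols and a presheaf over $\Omega$ of constant symbols (so each constant $c$ has an extent $Ec$). An element $M$ of $\mathrm{pSh}(\Omega,L)$ is a presheaf with: for each $n$-ary $R$ a map $R^M:|M|^n\to\Omega$ with $R^M(\bar a)\le E\bar a$ and $[\bar a=\bar b]_M\wedge R^M(\bar a)\le R^M(\bar b)$; for each $n$-ary $f$ a map $f^M:|M|^n\to|M|$ with $Ef^M(\bar a)=E\bar a$ and $[\bar a=\bar b]_M\le[f^M(\bar a)=f^M(\bar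 b)]_M$; for each constant $c$ a section $\mathfrak c^M$ with $E\mathfrak c^M=Ec$, compatibly with restriction. **Languages.** $L$ is one of $\bar L_{\omega\omega}$ (first order logic), $\bar L_{\infty\omega}$, $L_{\infty\lambda}$ ($\lambda$ an infinite cardinal). Terms are built from variables, constants and function symbols; atomic formulae are $t_0=t_1$ and $R(t_0,\dots,t_{m-1})$; formulae are closed under $\neg$, $\to$, conjunctions $\bigwedge\Phi$ and disjunctions $\bigvee\Phi$ (finite for $\bar L_{\omega\omega}$, over arbitrary sets otherwise) of sets of formulae with a common set of fewer than $\lambda$ free variables ($\lambda=\omega$ for the barred languages), and quantifiers $\forall V,\exists V$ over a single variable (barred languages) or over sets $V$ of fewer than $\lambda$ variables ($L_{\infty\lambda}$). **Interpretation.** For a term or formula $\chi$, $E\chi=\bigwedge\{Ec:c\text{ occurs in }\chi\}$. For $E\bar a\le Et$: $v_i^M(\bar a)=a_i$, $c^M(\bar a)=\mathfrak c^M\upharpoonright E\bar a$, $f(t_0,\dots)^M(\bar a)=f^M(t_0^M(\bar a),\dots)$. For a formula $\phi$ put $e=E\bar a\wedge E\phi$. For atomic $\phi$: $[(t=s)(\bar a)]_M=e\wedge[t^M(\bar a\upharpoonright E\phi)=s^M(\bar a\upharpoonright E\phi)]_M$, $[R(t_0,\dots)(\bar a)]_M=e\wedge R^M(t_0^M(\bar a\upharpoonright E\phi),\dots)$. The connectives $\bigwedge,\bigvee,\to,\neg$ are interpreted by the corresponding operations of $\Omega$, met with $e$; $[\exists V\psi(\bar a)]_M=e\wedge\bigvee_{\bar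 t\in{}^V|M|}[\psi(\bar t,\bar a)]_M$, $[\forall V\psi(\bar a)]_M=e\wedge\bigwedge_{\bar t\in{}^V|M|}(E\bar t\to[\psi(\bar t,\bar a)]_M)$. **Unnesting.** An atomic formula is unnested if it is of the form $v_i=v_j$, $v_i=c$, $R(v_{i_0},\dots,v_{i_{n-1}})$ or $v_{i_n}=f(v_{i_0},\dots,v_{i_{n-1}})$ (equations between a variable and a constant, or between a variable and $f$ applied to variables, count as unnested in either order). For atomic $\phi$ define $\phi^\exists$ recursively: $\phi^\exists=\phi$ for $\phi$ unnested. If $\phi$ is $c=d$ with $c,d$ constants, $\phi^\exists$ is $\exists v_0\,(v_0=c\wedge v_0=d)$. If $\phi$ is $f(t_0,\dots,t_{m-1})=t_m$ with not all $t_i$ variables, let $S$ be the set of $i\le m$ with $t_i$ not a variable; choose distinct new variables $x_i$ ($i\in S$) not occurring in any $t_k$, and put $x_i=t_i$ for $i\notin S$; $\phi^\exists$ is obtained by prefixing $\exists x_i$, one for each $i\in S$, to the conjunction of the formulae $(x_i=t_i)^\exists$ ($i\in S$) and $f(x_0,\dots,x_{m-1})=x_m$. If $\phi$ is $t_m=f(t_0,\dots,t_{m-1})$ do the same with last conjunct $x_m=f(x_0,\dots,x_{m-1})$. If $\phi$ is $R(t_0,\dots,t_{m-1})$ with not all $t_i$ variables, do the same with $S\subseteq\{0,\dots,m-1\}$ and last conjunct $R(x_0,\dots,x_{m-1})$. For an arbitrary formula $\psi$, $\psi^\exists$ is obtained by replacing each atomic subformula $\phi$ of $\psi$ by $\phi^\exists$.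 *)

(* Defs.v *)
From HB Require Import structures.
From mathcomp Require Import all_boot all_order.
From mathcomp Require Import mathcomp_extra boolp classical_sets functions.
From mathcomp Require Import cardinality.

Set Implicit Arguments.
Unset Strict Implicit.
Unset Printing Implicit Defensive.

Import Order.TTheory.
Local Open Scope order_scope.

HB.mixin Record isCompleteHeyting (d : Order.disp_t) T
    & Order.TBLattice d T := {
  bigjoin : set T -> T;
  bigjoinP : forall A : set T, supremums A (bigjoin A);
  himp : T -> T -> T;
  himpP : forall p q r : T, (r <= himp p q) = (Order.meet r p <= q)
}.

#[short(type="cHeytingType")]
HB.structure Definition CompleteHeyting (d : Order.disp_t) :=
  { T of Order.TBLattice d T & isCompleteHeyting d T }.

Section CompleteHeytingTheory.
Variables (d : Order.disp_t) (Om : cHeytingType d).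
Implicit Types (A : set Om) (p x : Om).

Definition bigmeet A : Om := bigjoin (lbound A).
Definition hneg p : Om := himp p \bot.

Lemma bigjoin_ub A x : A x -> x <= bigjoin A.
Proof. by have [ub _] := bigjoinP A; exact: ub. Qed.

Lemma bigjoin_le A x : ubound A x -> bigjoin A <= x.
Proof. by have [_ le] := bigjoinP A; exact: le. Qed.

Lemma bigmeet_lb A x : A x -> bigmeet A <= x.
Proof. by move=> Ax; apply: bigjoin_le => y; exact. Qed.

Lemma bigmeet_ge A x : lbound A x -> x <= bigmeet A.
Proof. exact: bigjoin_ub. Qed.

End CompleteHeytingTheory.

Notation "\hjoin_ i F" := (bigjoin (range (fun i => F)))
  (at level 34, i name, F at level 41, format "\hjoin_ i  F") : order_scope.
Notation "\hmeet_ i F" := (bigmeet (range (fun i => F)))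
  (at level 34, i name, F at level 41, format "\hmeet_ i  F") : order_scope.

Definition eq_value (d : Order.disp_t) (Om : cHeytingType d) (T : Type)
    (E : T -> Om) (r : T -> Om -> T) (a b : T) : Om :=
  bigjoin [set p | p <= (E a `&` E b)%O /\ r a p = r b p]%classic.

Record presheaf (d : Order.disp_t) (Om : cHeytingType d) := Presheaf {
  sect :> Type;
  extent : sect -> Om;
  restr : sect -> Om -> sect;
  restr_extent : forall a, restr a (extent a) = a;
  extent_restr : forall a p, extent (restr a p) = extent a `&` p;
  restr_restr : forall a p q, restr (restr a p) q = restr a (p `&` q);
  presheaf_ext : forall a b,
    extent a = eq_value extent restr a b ->
    extent b = eq_value extent restr a b -> a = b
}.

Section Tuples.
Variables (d : Order.disp_t) (Om : cHeytingType d) (M : presheaf Om).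

Definition eqv (a b : M) : Om := eq_value (@extent d Om M) (@restr d Om M) a b.

(* A tuple of sections indexed by a (possibly infinite) type X is a function;
   the extent of the empty tuple is \top. *)
Definition textent (X : Type) (a : X -> M) : Om := \hmeet_ i extent (a i).
Definition trestr (X : Type) (a : X -> M) (p : Om) : X -> M :=
  fun i => restr (a i) p.
Definition teqv (X : Type) (a b : X -> M) : Om := \hmeet_ i eqv (a i) (b i).

End Tuples.

Record signature (d : Order.disp_t) (Om : cHeytingType d) := Signature {
  rel_sym : Type;
  rel_arity : rel_sym -> nat;
  fun_sym : Type;
  fun_arity : fun_sym -> nat;
  const_sym : presheaf Om
}.

Record structure (d : Order.disp_t) (Om : cHeytingType d) (S : signature Om) :=
  Structure {
  carrier :> presheaf Om;
  rel_int : forall R : rel_sym S, ('I_(rel_arity R) -> carrier) -> Om;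
  rel_int_extent : forall R a, rel_int (R := R) a <= textent a;
  rel_int_eqv : forall R a b,
    teqv a b `&` rel_int (R := R) a <= rel_int (R := R) b;
  fun_int : forall f : fun_sym S, ('I_(fun_arity f) -> carrier) -> carrier;
  fun_int_extent : forall f a, extent (fun_int (f := f) a) = textent a;
  fun_int_eqv : forall f a b,
    teqv a b <= eqv (fun_int (f := f) a) (fun_int (f := f) b);
  const_int : const_sym S -> carrier;
  const_int_extent : forall c, extent (const_int c) = extent c;
  const_int_restr : forall c p, const_int (restr c p) = restr (const_int c) p
}.

(* [BarFO], [BarInf] and [Inf lam] are the languages $\bar L_{\omega\omega}$,
   $\bar L_{\infty\omega}$ and $L_{\infty\lambda}$, the infinite cardinal
   $\lambda$ being given by a type of that cardinality. *)
Inductive language :=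
| BarFO
| BarInf
| Inf (lam : Type) of infinite_set [set: lam]%classic.

(* Sets of formulae, of bound variables and of free variables are given by their
   index types, which [index_ok], [block_ok] and [context_ok] restrict. *)
Definition fewer_than (V lam : Type) : Prop :=
  ([set: V] #<= [set: lam])%card /\ ~ ([set: lam] #<= [set: V])%card.

Definition index_ok (L : language) (I : Type) : Prop :=
  match L with
  | BarFO => finite_set [set: I]%classic
  | BarInf | Inf _ _ => True
  end.

Definition block_ok (L : language) (V : Type) : Prop :=
  match L with
  | BarFO | BarInf => ([set: V] #= [set: unit])%card
  | Inf lam _ => fewer_than V lam
  end.

Definition context_ok (L : language) (X : Type) : Prop :=
  match L with
  | BarFO | BarInf => finite_set [set: X]%classic
  | Inf lam _ => fewer_than X lam
  end.

Lemma index_ok_fin (L : language) (I : finType) : index_ok L I.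
Proof. by case: L => //=; exact: finite_finset. Qed.

Lemma block_ok_unit (L : language) : block_ok L unit.
Proof.
case: L => [||lam inf_lam] /=; try exact: card_eqxx.
split=> [|le]; last first.
  by apply: inf_lam; apply: card_le_finite le _; exact: finite_finset.
have [x _] := infinite_setN0 inf_lam.
have inj : {in [set: unit]%classic &, injective (fun _ : unit => x)}.
  by move=> [] [].
by rewrite -(card_le_eql (inj_card_eq inj)); exact: card_leT.
Qed.

(* Terms and formulae are indexed by the type [X] of their free variables;
   a quantifier over the block [V] of variables passes from [V + X] to [X].
   If [context_ok L X] holds then every subformula, having its free variables in
   a type obtained from [X] by adding finitely many blocks, also has fewer than
   $\lambda$ free variables, so [form] itself does not impose this.  New variables
   are added to the context, hence distinct from all others. *)

Section Syntax.
Variables (d : Order.disp_t) (Om : cHeytingType d) (S : signature Om).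

Inductive term (X : Type) : Type :=
| Var (x : X)
| Cst (c : const_sym S)
| App (f : fun_sym S) (ts : 'I_(fun_arity f) -> term X).

Arguments Var {X} x.
Arguments Cst {X} c.
Arguments App {X} f ts.

Fixpoint rename_term (X Y : Type) (r : X -> Y) (t : term X) : term Y :=
  match t with
  | Var x => Var (r x)
  | Cst c => Cst c
  | App f ts => App f (fun i => rename_term r (ts i))
  end.

Definition is_var (X : Type) (t : term X) : bool :=
  if t is Var _ then true else false.

Fixpoint term_consts (X : Type) (t : term X) : set (const_sym S) :=
  match t with
  | Var _ => set0
  | Cst c => [set c]
  | App f ts => [set c | exists i, term_consts (ts i) c]
  end%classic.

Variable L : language.

Inductive form (X : Type) : Type :=
| Eq (t s : term X)
| Rel (R : rel_sym S) (ts : 'I_(rel_arity R) -> term X)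
| Neg (phi : form X)
| Imp (phi psi : form X)
| Conj (I : Type) (ok : index_ok L I) (phis : I -> form X)
| Disj (I : Type) (ok : index_ok L I) (phis : I -> form X)
| Exi (V : Type) (ok : block_ok L V) (phi : form (V + X))
| All (V : Type) (ok : block_ok L V) (phi : form (V + X)).

Arguments Eq {X} t s.
Arguments Rel {X} R ts.
Arguments Neg {X} phi.
Arguments Imp {X} phi psi.
Arguments Conj {X} I ok phis.
Arguments Disj {X} I ok phis.
Arguments Exi {X} V ok phi.
Arguments All {X} V ok phi.

Fixpoint form_consts (X : Type) (phi : form X) : set (const_sym S) :=
  match phi with
  | Eq t s => term_consts t `|` term_consts s
  | Rel R ts => [set c | exists i, term_consts (ts i) c]
  | Neg phi => form_consts phi
  | Imp phi psi => form_consts phi `|` form_consts psi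
  | Conj J _ phis => [set c | exists i, form_consts (phis i) c]
  | Disj J _ phis => [set c | exists i, form_consts (phis i) c]
  | Exi V _ phi => form_consts phi
  | All V _ phi => form_consts phi
  end%classic.

Definition form_extent (X : Type) (phi : form X) : Om :=
  bigmeet (@extent d Om (const_sym S) @` form_consts phi)%classic.

End Syntax.

Arguments Var {d Om S X} x.
Arguments Cst {d Om S X} c.
Arguments App {d Om S X} f ts.
Arguments Eq {d Om S L X} t s.
Arguments Rel {d Om S L X} R ts.
Arguments Neg {d Om S L X} phi.
Arguments Imp {d Om S L X} phi psi.
Arguments Conj {d Om S L X} I ok phis.
Arguments Disj {d Om S L X} I ok phis.
Arguments Exi {d Om S L X} V ok phi.
Arguments All {d Om S L X} V ok phi.

Section Interpretation.
Variables (d : Order.disp_t) (Om : cHeytingType d) (S : signature Om).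
Variables (M : structure S) (L : language).

(* Total; only meaningful when the extent of [a] is below that of the term. *)
Fixpoint term_val (X : Type) (t : term S X) (a : X -> M) : M :=
  match t with
  | Var x => a x
  | Cst c => restr (const_int M c) (textent a)
  | App f ts => fun_int (fun i => term_val (ts i) a)
  end.

Definition tuple_cat (V X : Type) (b : V -> M) (a : X -> M) : V + X -> M :=
  fun z => match z with inl v => b v | inr x => a x end.

Fixpoint form_val (X : Type) (phi : form S L X) : (X -> M) -> Om :=
  fun a =>
  let ap := trestr a (form_extent phi) in
  textent a `&` form_extent phi `&`
  match phi with
  | Eq t s => fun _ ap => eqv (term_val t ap) (term_val s ap)
  | Rel R ts => fun _ ap => rel_int (fun i => term_val (ts i) ap)
  | Neg phi => fun a _ => hneg (form_val phi a)
  | Imp phi psi => fun a _ => himp (form_val phi a) (form_val psi a)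
  | Conj J _ phis => fun a _ => \hmeet_ i (form_val (phis i) a)
  | Disj J _ phis => fun a _ => \hjoin_ i (form_val (phis i) a)
  | Exi V _ phi => fun a _ => \hjoin_ b (form_val phi (tuple_cat b a))
  | All V _ phi => fun a _ =>
      \hmeet_ b (himp (textent b) (form_val phi (tuple_cat b a)))
  end a ap.

End Interpretation.

Section Prefix.
Variables (d : Order.disp_t) (Om : cHeytingType d) (S : signature Om).
Variable L : language.

(* [X] together with [k] new variables, each bound by its own quantifier *)
Fixpoint ext (X : Type) (k : nat) : Type :=
  if k is k'.+1 then (unit + ext X k')%type else X.

Fixpoint old (X : Type) (k : nat) : X -> ext X k :=
  if k is k'.+1 return X -> ext X k then fun x => inr (old k' x) else id.

Fixpoint new (X : Type) (k : nat) : 'I_k -> ext X k :=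
  match k return 'I_k -> ext X k with
  | 0 => fun i => match notF (ltn_ord i) with end
  | k'.+1 => fun i =>
      if unlift ord_max i is Some j then inr (new X j) else inl tt
  end.

Fixpoint exists_new (X : Type) (k : nat) : form S L (ext X k) -> form S L X :=
  match k return form S L (ext X k) -> form S L X with
  | 0 => id
  | k'.+1 => fun phi => exists_new (Exi unit (block_ok_unit L) phi)
  end.

(* For a finite family [ts] of terms, [unnest_ctx ts] adds to [X] one new
   variable for each index whose term is not a variable, and [unnest_name ts j]
   is the variable $x_j$. *)
Definition nonvar (X : Type) (J : finType) (ts : J -> term S X) : finType :=
  {j : J | ~~ is_var (ts j)}.

Definition unnest_ctx (X : Type) (J : finType) (ts : J -> term S X) : Type :=
  ext X #|nonvar ts|.

Definition unnest_name (X : Type) (J : finType) (ts : J -> term S X) (j : J) :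
    unnest_ctx ts :=
  match ts j as t return (~~ is_var t -> ~~ is_var (ts j)) -> unnest_ctx ts with
  | Var x => fun _ => old _ x
  | Cst _ | App _ _ => fun h =>
      new X (enum_rank (exist _ j (h isT) : nonvar ts))
  end id.

(* [atom x] is the atomic formula with each term $t_j$ replaced by $x_j$, and
   [arg j z] is $(z = t_j)^\exists$. *)
Definition unnest_args (X : Type) (J : finType) (ts : J -> term S X)
    (atom : forall Y, (J -> term S Y) -> form S L Y)
    (arg : J -> unnest_ctx ts -> form S L (unnest_ctx ts)) : form S L X :=
  if [forall j, is_var (ts j)] then atom X ts
  else exists_new (k := #|nonvar ts|)
    (Conj (option (nonvar ts)) (index_ok_fin L _) (fun o =>
       if o is Some s then arg (val s) (unnest_name ts (val s))
       else atom (unnest_ctx ts) (fun j => Var (unnest_name ts j)))).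

End Prefix.

Section Unnesting.
Variables (d : Order.disp_t) (Om : cHeytingType d) (S : signature Om).
Variable L : language.

(* the family $t_0, \dots, t_{m-1}, t_m$, with [None] standing for $m$ *)
Definition snoc (A : Type) (m : nat) (ts : 'I_m -> A) (t : A) :
    option 'I_m -> A := fun o => if o is Some i then ts i else t.

Definition app_eq (f : fun_sym S) (Y : Type)
    (ts : option 'I_(fun_arity f) -> term S Y) : form S L Y :=
  Eq (App f (fun i => ts (Some i))) (ts None).
Definition eq_app (f : fun_sym S) (Y : Type)
    (ts : option 'I_(fun_arity f) -> term S Y) : form S L Y :=
  Eq (ts None) (App f (fun i => ts (Some i))).

(* [unnest_var r x t] is $(x = t)^\exists$ for [t] renamed along [r]; carrying
   the renaming makes the recursion structural.  See [unnest_varE]. *)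
Fixpoint unnest_var (X Y : Type) (r : X -> Y) (x : Y) (t : term S X) :
    form S L Y :=
  match t with
  | Var y => Eq (Var x) (Var (r y))
  | Cst c => Eq (Var x) (Cst c)
  | App f ts =>
      unnest_args (ts := snoc (fun i => rename_term r (ts i)) (Var x))
        (eq_app (f := f))
        (fun o z => match o with
                    | Some i => unnest_var (fun y => old _ (r y)) z (ts i)
                    | None => Eq (Var z) (Var (old _ x))
                    end)
  end.

(* An equation between two applications is treated as $f(\dots) = t_m$. *)
Definition unnest_eq (X : Type) (t s : term S X) : form S L X :=
  match t, s with
  | App f ts, _ =>
      unnest_args (ts := snoc ts s) (app_eq (f := f))
        (fun o z => unnest_var (old _) z (snoc ts s o))
  | _, App f ts =>
      unnest_args (ts := snoc ts t) (eq_app (f := f))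
        (fun o z => unnest_var (old _) z (snoc ts t o))
  | Cst c, Cst e =>
      Exi unit (block_ok_unit L)
        (Conj bool (index_ok_fin L _) (fun b =>
           if b then Eq (Var (inl tt)) (Cst c) else Eq (Var (inl tt)) (Cst e)))
  | _, _ => Eq t s
  end.

Definition unnest_rel (X : Type) (R : rel_sym S)
    (ts : 'I_(rel_arity R) -> term S X) : form S L X :=
  unnest_args (ts := ts) (fun Y => Rel R)
    (fun i z => unnest_var (old _) z (ts i)).

Fixpoint unnest (X : Type) (phi : form S L X) : form S L X :=
  match phi with
  | Eq t s => unnest_eq t s
  | Rel R ts => unnest_rel ts
  | Neg phi => Neg (unnest phi)
  | Imp phi psi => Imp (unnest phi) (unnest psi)
  | Conj J ok phis => Conj J ok (fun i => unnest (phis i))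
  | Disj J ok phis => Disj J ok (fun i => unnest (phis i))
  | Exi V ok phi => Exi V ok (unnest phi)
  | All V ok phi => All V ok (unnest phi)
  end.

Lemma rename_term_id (X : Type) (t : term S X) : rename_term id t = t.
Proof. by elim: t => //= f ts IH; congr App; apply: funext. Qed.

Lemma rename_term_comp (X Y Z : Type) (r : X -> Y) (q : Y -> Z)
    (t : term S X) :
  rename_term q (rename_term r t) = rename_term (fun x => q (r x)) t.
Proof. by elim: t => //= f ts IH; congr App; apply: funext. Qed.

Lemma unnest_var_rename (X Y Z : Type) (r : X -> Y) (q : Y -> Z) (x : Z)
    (t : term S X) :
  unnest_var q x (rename_term r t) = unnest_var (fun y => q (r y)) x t.
Proof.
elim: t Y Z r q x => //= f ts IH Y Z r q x.
have -> : (fun i => rename_term q (rename_term r (ts i))) =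
          (fun i => rename_term (fun y => q (r y)) (ts i)).
  by apply: funext => i; rewrite rename_term_comp.
by congr (unnest_args _ _); apply: funext => -[i|]; apply: funext => z //=; exact: IH.
Qed.

Lemma unnest_varE (X Y : Type) (r : X -> Y) (x : Y) (t : term S X) :
  unnest_var r x t = unnest (Eq (Var x) (rename_term r t)).
Proof.
case: t => //= f ts; congr (unnest_args _ _).
by apply: funext => -[i|]; apply: funext => z //=; rewrite unnest_var_rename.
Qed.

End Unnesting.

(* Main.v *)
(* [p <= eqv a b] is equivalent to [a] and [b] existing on [p] and having equal
   restrictions to [p].  Hence the truth value of an atomic formula [phi] lies
   above [p] iff the tuple and the constants of [phi] exist on [p] and the
   equation or relation holds on [p] of the term values; these depend on the
   tuple only up to equality on [p].  Consequently [t_j] and any [x_j] with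
   [x_j = t_j] on [p] are interchangeable in [phi], which bounds the value of
   the unnested formula by that of [phi], while the values of the [t_j] themselves
   are witnesses for the converse.  As unnesting preserves the set of constants,
   hence extents, the equality passes through connectives and quantifiers. *)

Require Import Defs.
From mathcomp Require Import all_boot all_order.
From mathcomp Require Import boolp classical_sets.

Set Implicit Arguments.
Unset Strict Implicit.
Unset Printing Implicit Defensive.

Import Order.TTheory.
Local Open Scope order_scope.

(** * Bounds on arbitrary meets and joins *)

Section HeytingBounds.
Variables (d : Order.disp_t) (Om : cHeytingType d).
Implicit Types (A : set Om) (p q : Om).

Lemma le_bigmeetP A p : p <= bigmeet A <-> (forall x, A x -> p <= x).
Proof.
split=> [le x Ax|lb]; last exact: bigmeet_ge.
exact: le_trans le (bigmeet_lb Ax).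
Qed.

Lemma le_hmeetP (I : Type) (F : I -> Om) p :
  p <= \hmeet_ i F i <-> (forall i, p <= F i).
Proof.
rewrite le_bigmeetP; split=> [le i|le _ [i _ <-]]; last exact: le.
by apply: le; exists i.
Qed.

Lemma le_hjoin (I : Type) (F : I -> Om) i : F i <= \hjoin_ j F j.
Proof. by apply: bigjoin_ub; exists i. Qed.

Lemma hjoin_le (I : Type) (F : I -> Om) q :
  (forall i, F i <= q) -> \hjoin_ i F i <= q.
Proof. by move=> le; apply: bigjoin_le => _ [i _ <-]. Qed.

Lemma eq_by_le p q : (forall r, r <= p <-> r <= q) -> p = q.
Proof. by move=> H; apply/eqP; rewrite eq_le; apply/andP; split; apply/H. Qed.

End HeytingBounds.

(** * Equality of sections below a truth value *)

Section PresheafEquality.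
Variables (d : Order.disp_t) (Om : cHeytingType d) (M : presheaf Om).
Implicit Types (a b c : M) (p q : Om).

Lemma eqv_le_extent a b : eqv a b <= extent a `&` extent b.
Proof. by apply: bigjoin_le => p []. Qed.

Lemma le_eqv_restr a b p :
  p <= extent a `&` extent b -> restr a p = restr b p -> p <= eqv a b.
Proof. by move=> le e; apply: bigjoin_ub. Qed.

(* The supremum defining [eqv a b] is attained: both restrictions have it as
   extent and as truth value of their equality, so extensionality applies. *)
Lemma restr_eqv a b : restr a (eqv a b) = restr b (eqv a b).
Proof.
set q := eqv a b.
have /andP[qa qb] : (q <= extent a) && (q <= extent b).
  by rewrite -lexI eqv_le_extent.
have Ea : extent (restr a q) = q by rewrite extent_restr; apply/meet_r.
have Eb : extent (restr b q) = q by rewrite extent_restr; apply/meet_r.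
suff qE : q = eqv (restr a q) (restr b q).
  by apply: presheaf_ext; rewrite ?Ea ?Eb; exact: qE.
apply/eqP; rewrite eq_le; apply/andP; split.
  apply: bigjoin_le => p [lep ep].
  have pq : p <= q by apply: bigjoin_ub.
  apply: le_eqv_restr; first by rewrite Ea Eb meetxx.
  by rewrite !restr_restr (meet_r pq).
by apply: le_trans (eqv_le_extent _ _) _; rewrite Ea Eb meetxx.
Qed.

(** As [a] and [b] agree when restricted to [eqv a b], they agree when restricted further to any [p]
    below it. *)
Lemma le_eqvP a b p :
  p <= eqv a b <-> [/\ p <= extent a, p <= extent b & restr a p = restr b p].
Proof.
split=> [le|[pa pb e]]; last by apply: le_eqv_restr; rewrite // lexI pa.
have := le_trans le (eqv_le_extent a b).
rewrite lexI => /andP[-> ->]; split=> //.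
by rewrite -(meet_r le) -!restr_restr restr_eqv.
Qed.

Lemma le_eqv_refl a p : p <= extent a -> p <= eqv a a.
Proof. by move=> le; apply/le_eqvP. Qed.

Lemma le_eqv_sym a b p : p <= eqv a b -> p <= eqv b a.
Proof. by move=> /le_eqvP[? ? ?]; apply/le_eqvP. Qed.

Lemma le_eqv_trans b a c p : p <= eqv a b -> p <= eqv b c -> p <= eqv a c.
Proof.
move=> /le_eqvP[pa _ eab] /le_eqvP[_ pc ebc]; apply/le_eqvP; split=> //.
by rewrite eab.
Qed.

Lemma le_eqv_restrr a q p : p <= extent a -> p <= q -> p <= eqv a (restr a q).
Proof.
move=> pa pq; apply/le_eqvP; split=> //; first by rewrite extent_restr lexI pa.
by rewrite restr_restr (meet_r pq).
Qed.

Lemma le_extent_restr a q p :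
  p <= extent (restr a q) <-> p <= extent a /\ p <= q.
Proof. by rewrite extent_restr lexI; split=> [/andP|[-> ->]]. Qed.

Lemma le_textentP (X : Type) (a : X -> M) p :
  p <= textent a <-> (forall x, p <= extent (a x)).
Proof. exact: le_hmeetP. Qed.

Lemma textent_le (X : Type) (a : X -> M) p x :
  p <= textent a -> p <= extent (a x).
Proof. by move=> /le_textentP. Qed.

Lemma le_teqvP (X : Type) (a b : X -> M) p :
  p <= teqv a b <-> (forall x, p <= eqv (a x) (b x)).
Proof. exact: le_hmeetP. Qed.

End PresheafEquality.

(** * Elements below the truth values of formulae *)

Section Forcing.
Variables (d : Order.disp_t) (Om : cHeytingType d) (S : signature Om).
Variables (M : structure S) (L : language).
Implicit Types p q : Om.

(** This is $p \le Et$, spelled out over the constants so that it passes directly to subterms. *)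
Definition below_term (X : Type) p (t : term S X) : Prop :=
  forall c, term_consts t c -> p <= extent c.

Lemma term_consts_rename (X Y : Type) (r : X -> Y) (t : term S X) :
  term_consts (rename_term r t) = term_consts t.
Proof.
elim: t => //= f ts IH; apply/seteqP.
by split=> c [i]; [rewrite IH|rewrite -IH] => ?; exists i.
Qed.

Lemma below_term_rename (X Y : Type) (r : X -> Y) (t : term S X) p :
  below_term p (rename_term r t) <-> below_term p t.
Proof. by rewrite /below_term term_consts_rename. Qed.

(* The value of a term depends on the tuple only locally, although a constant is
   restricted to the extent of the whole tuple. *)
Lemma term_val_rename (X Y : Type) (r : X -> Y) (t : term S X)
    (a : X -> M) (b : Y -> M) p :
  p <= textent a -> p <= textent b -> below_term p t ->
  (forall x, p <= eqv (a x) (b (r x))) ->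
  p <= eqv (term_val t a) (term_val (rename_term r t) b).
Proof.
move=> pa pb + pab; elim: t => [x|c|f ts IH] /= pt; first exact: pab.
  have pc : p <= extent (const_int M c) by rewrite const_int_extent; exact: pt.
  (* Both values are restrictions of the section [const_int M c] to extents above [p], so it serves
     as the middle term. *)
  apply: (@le_eqv_trans _ _ _ (const_int M c)); last exact: le_eqv_restrr.
  by apply: le_eqv_sym; exact: le_eqv_restrr.
apply: le_trans (fun_int_eqv _ _); apply/le_teqvP => i.
by apply: IH => c tc; apply: pt; exists i.
Qed.

Lemma term_val_eqv (X : Type) (t : term S X) (a b : X -> M) p :
  p <= textent a -> p <= textent b -> below_term p t ->
  (forall x, p <= eqv (a x) (b x)) ->
  p <= eqv (term_val t a) (term_val t b).
Proof.
by move=> pa pb pt pab; rewrite -{2}[t]rename_term_id; exact: term_val_rename.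
Qed.

(** Serves to compare a constant outside and inside a quantifier, where it is restricted to
    different extents. *)
Lemma term_val_cat (V X : Type) (t : term S X) (b : V -> M) (a : X -> M) p :
  p <= textent (tuple_cat b a) -> below_term p t ->
  p <= eqv (term_val t a) (term_val (rename_term inr t) (tuple_cat b a)).
Proof.
move=> pba; have pa x : p <= extent (a x) by exact: (textent_le (inr x) pba).
move=> pt; apply: term_val_rename => // [|x]; first exact/le_textentP.
exact: le_eqv_refl.
Qed.

(** Removes the restriction of the tuple to $E\phi$ that the interpretation of an atomic $\phi$
    imposes. *)
Lemma term_val_trestr (X : Type) (t : term S X) (a : X -> M) p q :
  p <= textent a -> p <= q -> below_term p t ->
  p <= eqv (term_val t a) (term_val t (trestr a q)).
Proof.
move=> pa pq pt; have /le_textentP pax := pa.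
apply: term_val_eqv => // [|x]; last exact: le_eqv_restrr.
by apply/le_textentP => x; apply/le_extent_restr.
Qed.

(** Equality of a value with itself on [p] includes its existence on [p], so congruence already
    gives the bound on the extent. *)
Lemma le_term_extent (X : Type) (t : term S X) (a : X -> M) p :
  p <= textent a -> below_term p t -> p <= extent (term_val t a).
Proof.
move=> pa pt; suff /le_eqvP[] : p <= eqv (term_val t a) (term_val t a) by [].
by apply: term_val_eqv => // x; apply: le_eqv_refl; exact: textent_le.
Qed.

Lemma le_form_extentP (X : Type) (phi : form S L X) p :
  p <= form_extent phi <-> (forall c, form_consts phi c -> p <= extent c).
Proof.
rewrite le_bigmeetP; split=> [le c pc|le _ [c pc <-]]; last exact: le.
by apply: le; exists c.
Qed.

Lemma le_form_val (X : Type) (phi : form S L X) (a : X -> M) p :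
  p <= form_val phi a -> p <= textent a /\ p <= form_extent phi.
Proof. by case: phi => /= >; rewrite !lexI => /andP[/andP[]]. Qed.

Lemma le_EqP (X : Type) (t s : term S X) (a : X -> M) p :
  p <= form_val (Eq (L := L) t s) a <->
  [/\ p <= textent a, below_term p t, below_term p s &
      p <= eqv (term_val t a) (term_val s a)].
Proof.
rewrite /= !lexI; split=> [/andP[/andP[pa pe] pv]|[pa pt ps pv]].
  have /le_form_extentP /= pc := pe.
  have pt : below_term p t by move=> c tc; apply: pc; left.
  have ps : below_term p s by move=> c sc; apply: pc; right.
  split=> //; apply: le_eqv_trans (term_val_trestr pa pe pt) _.
  by apply: le_eqv_trans pv _; apply: le_eqv_sym; exact: term_val_trestr.
have pe : p <= form_extent (Eq (L := L) t s).
  by apply/le_form_extentP => c /= [/pt|/ps].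
rewrite pa pe /=.
apply: le_eqv_trans (le_eqv_trans pv (term_val_trestr pa pe ps)).
by apply: le_eqv_sym; exact: term_val_trestr.
Qed.

Lemma rel_int_congr (R : rel_sym S) (u v : 'I_(rel_arity R) -> M) p :
  (forall i, p <= eqv (u i) (v i)) -> p <= rel_int u -> p <= rel_int v.
Proof.
by move=> /le_teqvP puv pu; apply: le_trans (rel_int_eqv u v); rewrite lexI puv.
Qed.

Lemma le_RelP (X : Type) (R : rel_sym S) (ts : 'I_(rel_arity R) -> term S X)
    (a : X -> M) p :
  p <= form_val (Rel (L := L) R ts) a <->
  [/\ p <= textent a, forall i, below_term p (ts i) &
      p <= rel_int (fun i => term_val (ts i) a)].
Proof.
rewrite /= !lexI; split=> [/andP[/andP[pa pe] pv]|[pa pt pv]].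
  have /le_form_extentP /= pc := pe.
  have pt i : below_term p (ts i) by move=> c tc; apply: pc; exists i.
  split=> //; apply: rel_int_congr pv => i.
  by apply: le_eqv_sym; exact: term_val_trestr.
have pe : p <= form_extent (Rel (L := L) R ts).
  by apply/le_form_extentP => c /= [i /pt].
rewrite pa pe /=; apply: rel_int_congr pv => i; exact: term_val_trestr.
Qed.

(** The extent of the conjunction needs no separate condition: each conjunct's value lies below the
    extents of its own constants. *)
Lemma le_ConjP (X I : Type) (ok : index_ok L I) (phis : I -> form S L X)
    (a : X -> M) p :
  p <= form_val (Conj I ok phis) a <->
  p <= textent a /\ forall i, p <= form_val (phis i) a.
Proof.
rewrite /= !lexI; split=> [/andP[/andP[pa _] /le_hmeetP pv] //|[pa pv]].
rewrite pa /=; apply/andP; split; last exact/le_hmeetP.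
apply/le_form_extentP => c /= [i]; move: c; apply/le_form_extentP.
by have [] := le_form_val (pv i).
Qed.

Lemma le_exists_form_val (X : Type) (V : Type) (ok : block_ok L V)
    (phi : form S L (V + X)) (b : V -> M) (a : X -> M) :
  form_val phi (tuple_cat b a) <= form_val (Exi V ok phi) a.
Proof.
have [pba pe] := le_form_val (lexx (form_val phi (tuple_cat b a))).
rewrite /= !lexI (le_hjoin (fun b => form_val phi (tuple_cat b a))) andbT.
apply/andP; split; last exact: pe.
by apply/le_textentP => x; exact: (textent_le (inr x) pba).
Qed.

Lemma exists_form_val_le (X : Type) (V : Type) (ok : block_ok L V)
    (phi : form S L (V + X)) (a : X -> M) q :
  (forall b, form_val phi (tuple_cat b a) <= q) ->
  form_val (Exi V ok phi) a <= q.
Proof. by move=> le; rewrite /= leIx2 // hjoin_le ?orbT. Qed.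

Lemma form_consts_exists_new (X : Type) k (phi : form S L (ext X k)) :
  form_consts (exists_new phi) = form_consts phi.
Proof. by elim: k phi => //= k IH phi; rewrite IH. Qed.

(** Together with [exists_new_le], this makes the value of [exists_new phi] at a tuple the join of
    the values of [phi] over all extensions of the tuple to the new variables. *)
Lemma le_exists_new (X : Type) k (phi : form S L (ext X k))
    (b : ext X k -> M) :
  form_val phi b <= form_val (exists_new phi) (b \o @old X k).
Proof.
elim: k phi b => [|k IH] //= phi b.
apply: le_trans (IH (Exi unit (block_ok_unit L) phi) (b \o inr)).
have -> : b = tuple_cat (b \o inl) (b \o inr) by apply: funext => -[].
exact: le_exists_form_val.
Qed.

Lemma exists_new_le (X : Type) k (phi : form S L (ext X k)) (a : X -> M) q :
  (forall b, b \o @old X k = a -> form_val phi b <= q) ->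
  form_val (exists_new phi) a <= q.
Proof.
elim: k phi => [|k IH] //= phi le; first exact: le.
by apply: IH => b ba; apply: exists_form_val_le => c; exact: le.
Qed.

End Forcing.

(** * Valuations of the new variables *)

Section NewVariables.
Variables (d : Order.disp_t) (Om : cHeytingType d) (S : signature Om).

(** The recursion follows that of [new]: [ord_max] is the variable added last, the outermost summand
    of [ext X k]. *)
Fixpoint ext_val (A X : Type) (a : X -> A) k : ('I_k -> A) -> ext X k -> A :=
  match k return ('I_k -> A) -> ext X k -> A with
  | 0 => fun _ => a
  | k'.+1 => fun c z => match z with
      | inl _ => c ord_max
      | inr y => ext_val a (fun i => c (lift ord_max i)) y
      end
  end.

Lemma ext_val_old (A X : Type) (a : X -> A) k (c : 'I_k -> A) :
  ext_val a c \o @old X k = a.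
Proof.
by elim: k c => //= k IH c; rewrite -{2}(IH (fun i => c (lift ord_max i))).
Qed.

Lemma ext_val_new (A X : Type) (a : X -> A) k (c : 'I_k -> A) i :
  ext_val a c (new X i) = c i.
Proof.
elim: k c i => [c [] //|k IH c i] /=.
by case: unliftP => [j ->|->] //=; rewrite IH.
Qed.

Variables (X : Type) (J : finType) (ts : J -> term S X).

Lemma unnest_name_var j x : ts j = Var x -> unnest_name ts j = old _ x.
Proof.
(* With [id] generalised to a function variable, the matched term can vary in its domain while
   [ts j] stays in its codomain, which keeps the case analysis well typed. *)
move=> tj; rewrite /unnest_name; move: id tj.
by case: {1 3 4}(ts j) => // y _ [->].
Qed.

Lemma unnest_name_nonvar j (h : ~~ is_var (ts j)) :
  unnest_name ts j = new X (enum_rank (exist _ j h : nonvar ts)).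
Proof.
rewrite /unnest_name; have := h; move: id.
case: {1 3 4}(ts j) => // [c|f us] g _;
  by rewrite (bool_irrelevance (g isT) h).
Qed.

End NewVariables.

(** * Unnesting a single atomic formula *)

Section UnnestArgs.
Variables (d : Order.disp_t) (Om : cHeytingType d) (S : signature Om).
Variables (M : structure S) (L : language).
Variables (X : Type) (J : finType) (ts : J -> term S X).
Variable atom : forall Y, (J -> term S Y) -> form S L Y.
Variable arg : J -> unnest_ctx ts -> form S L (unnest_ctx ts).

(** A term containing a constant is not a variable, so its constants reappear in its conjunct [arg];
    the atomic conjunct contains only variables. *)
Lemma unnest_args_consts :
  (forall Y (us : J -> term S Y),
     form_consts (atom us) =
       [set c | exists j, term_consts (us j) c]%classic) ->
  (forall j z, ~~ is_var (ts j) ->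
     form_consts (arg j z) = term_consts (ts j)) ->
  form_consts (unnest_args atom arg) =
    [set c | exists j, term_consts (ts j) c]%classic.
Proof.
move=> atomE argE; rewrite /unnest_args; case: ifP => _; first exact: atomE.
rewrite form_consts_exists_new /=; apply/seteqP; split=> c /=.
  case=> -[s|]; last by rewrite atomE => -[].
  by rewrite argE ?(valP s) // => sc; exists (val s).
case=> j jc; have h : ~~ is_var (ts j) by case: (ts j) jc.
by exists (Some (exist _ j h : nonvar ts)); rewrite argE.
Qed.

(** [A] is the truth value of the atomic formula as a function of the values of its terms. Keeping
    it abstract treats relations and both orientations of $f(\dots)=t$ at once. *)
Variable A : (J -> M) -> Om.

Hypothesis A_eqv : forall (u v : J -> M) p,
  (forall j, p <= eqv (u j) (v j)) -> p <= A u -> p <= A v.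
Hypothesis le_atomP : forall Y (us : J -> term S Y) (b : Y -> M) p,
  p <= form_val (atom us) b <->
  [/\ p <= textent b, forall j, below_term p (us j) &
      p <= A (fun j => term_val (us j) b)].
Hypothesis arg_val : forall j z (b : unnest_ctx ts -> M), ~~ is_var (ts j) ->
  form_val (arg j z) b =
  form_val (Eq (L := L) (Var z) (rename_term (@old X #|nonvar ts|) (ts j))) b.

Lemma unnest_args_val (a : X -> M) :
  form_val (unnest_args atom arg) a = form_val (atom ts) a.
Proof.
rewrite /unnest_args; case: ifP => // _.
apply/eqP; rewrite eq_le; apply/andP; split.
  apply: exists_new_le => b ba; set p := form_val _ b.
  have /le_ConjP[pb pphi] := lexx p.
  have /le_atomP[_ _ pA] := pphi None.
  have pa : p <= textent a.
    by rewrite -ba; apply/le_textentP => x; exact: textent_le pb.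
  (* If $t_j$ is not a variable, its conjunct makes $x_j$ and $t_j$ agree on [p]; otherwise $x_j$ is
     $t_j$ itself as an old variable. *)
  have pj j : below_term p (ts j) /\
      p <= eqv (b (unnest_name ts j)) (term_val (ts j) a).
    have [h|] := boolP (~~ is_var (ts j)).
      have := pphi (Some (exist _ j h : nonvar ts)) => /=.
      rewrite arg_val // => /le_EqP[_ _ /below_term_rename pt pv]; split=> //.
      apply: le_eqv_trans pv _; apply: le_eqv_sym; apply: term_val_rename => //.
      move=> x; rewrite -ba; apply: le_eqv_refl.
      exact: (textent_le (old _ x) pb).
    case tj: (ts j) => [x||] // _; split=> //=; rewrite (unnest_name_var tj).
    rewrite -[b _]/((b \o @old X _) x) ba; apply: le_eqv_refl.
    exact: textent_le.
  apply/le_atomP; split=> // [j|]; first by case: (pj j).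
  by apply: A_eqv pA => j /=; case: (pj j).
set p := form_val _ a; have /le_atomP[pa pt pA] := lexx p.
(* The witnesses are the values of the non-variable terms, in the order in which [unnest_name]
   numbers them. *)
pose c (i : 'I_#|nonvar ts|) := term_val (ts (val (enum_val i))) a.
pose b := ext_val a c.
have ba : b \o @old X _ = a by exact: ext_val_old.
have bname j : b (unnest_name ts j) = term_val (ts j) a.
  have [h|] := boolP (~~ is_var (ts j)).
    by rewrite (unnest_name_nonvar h) /b ext_val_new /c enum_rankK.
  case tj: (ts j) => [x||] // _; rewrite (unnest_name_var tj) /=.
  by rewrite -[b _]/((b \o @old X _) x) ba.
have pb : p <= textent b.
  apply/le_textentP.
  have : forall i, p <= extent (c i) by move=> i; exact: le_term_extent.
  (* Only the existence of the sections [c i] on [p] is kept, so that induction on the number of new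
     variables applies. *)
  move/le_textentP: pa; rewrite /b; move: (c); clear.
  by elim: #|_| => //= k IH c pa pc [_|y] //; exact: IH.
rewrite -ba; apply: le_trans (le_exists_new _ _).
apply/le_ConjP; split=> // -[[j h]|] /=; last first.
  apply/le_atomP; split=> // [? ? []|]; apply: A_eqv pA => j /=; rewrite bname.
  by apply: le_eqv_refl; exact: le_term_extent.
rewrite arg_val //; apply/le_EqP; split=> //=.
  exact/below_term_rename.
rewrite bname; apply: term_val_rename => // x.
rewrite -[b _]/((b \o @old X _) x) ba; apply: le_eqv_refl.
exact: textent_le.
Qed.

End UnnestArgs.

(** * Constants and truth values of unnested formulae *)

Section Unnest.
Variables (d : Order.disp_t) (Om : cHeytingType d) (S : signature Om).
Variable L : language.

Lemma app_eq_consts (f : fun_sym S) (Y : Type)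
    (us : option 'I_(fun_arity f) -> term S Y) :
  form_consts (app_eq L us) = [set c | exists o, term_consts (us o) c]%classic.
Proof.
apply/seteqP; split=> c /=; last by case=> -[i|] ?; [left; exists i|right].
by case=> [[i]|] ?; [exists (Some i)|exists None].
Qed.

Lemma eq_app_consts (f : fun_sym S) (Y : Type)
    (us : option 'I_(fun_arity f) -> term S Y) :
  form_consts (eq_app L us) = [set c | exists o, term_consts (us o) c]%classic.
Proof. by rewrite -app_eq_consts /= setUC. Qed.

Lemma snoc_consts (X : Type) m (ts : 'I_m -> term S X) (t : term S X) :
  [set c | exists o, term_consts (snoc ts t o) c]%classic =
  ([set c | exists i, term_consts (ts i) c] `|` term_consts t)%classic.
Proof.
apply/seteqP; split=> c /=; first by case=> -[i|] ?; [left; exists i|right].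
by case=> [[i]|] ?; [exists (Some i)|exists None].
Qed.

Lemma unnest_var_consts (X Y : Type) (r : X -> Y) (x : Y) (t : term S X) :
  form_consts (unnest_var L r x t) = term_consts t.
Proof.
elim: t Y r x => [y|c|f ts IH] Y r x /=; rewrite ?set0U ?setU0 //.
rewrite unnest_args_consts; first last.
- by case=> [i|] z //= _; rewrite IH term_consts_rename.
- by move=> Z us; exact: eq_app_consts.
rewrite snoc_consts /= setU0; apply/seteqP.
by split=> c [i ic]; exists i; rewrite term_consts_rename in ic *.
Qed.

Lemma unnest_eq_consts (X : Type) (t s : term S X) :
  form_consts (unnest_eq L t s) = (term_consts t `|` term_consts s)%classic.
Proof.
case: t s => [x|c|f ts] [y|e|g us] //=.
1,3: rewrite unnest_args_consts; [|move=> Z vs; exact: eq_app_consts|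
       by move=> *; rewrite unnest_var_consts]; rewrite snoc_consts setUC //.
  apply/seteqP; split=> k /=; last first.
    by case=> ?; [exists true|exists false]; right.
  by case=> -[] [] // ?; [left|right].
all: rewrite unnest_args_consts ?snoc_consts // => *;
  first [exact: app_eq_consts|exact: unnest_var_consts].
Qed.

Lemma unnest_rel_consts (X : Type) (R : rel_sym S)
    (ts : 'I_(rel_arity R) -> term S X) :
  form_consts (unnest_rel L ts) = form_consts (Rel (L := L) R ts).
Proof. by rewrite unnest_args_consts // => *; exact: unnest_var_consts. Qed.

Lemma unnest_consts (X : Type) (phi : form S L X) :
  form_consts (unnest phi) = form_consts phi.
Proof.
elim: phi => {X} [X t s|X R ts|X phi IH|X phi IHphi psi IHpsi|
    X I ok phis IH|X I ok phis IH|X V ok phi IH|X V ok phi IH] /=.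
- exact: unnest_eq_consts.
- exact: unnest_rel_consts.
- exact: IH.
- by rewrite IHphi IHpsi.
- by apply/seteqP; split=> c [i ic]; exists i; rewrite IH in ic *.
- by apply/seteqP; split=> c [i ic]; exists i; rewrite IH in ic *.
- exact: IH.
- exact: IH.
Qed.

Variable M : structure S.

Lemma fun_int_congr (f : fun_sym S) (u v : 'I_(fun_arity f) -> M) p :
  (forall i, p <= eqv (u i) (v i)) -> p <= eqv (fun_int u) (fun_int v).
Proof. by move=> /le_teqvP puv; apply: le_trans (fun_int_eqv u v). Qed.

(** The instance of [A] for both [app_eq] and [eq_app], equality being symmetric. *)
Definition app_eqv (f : fun_sym S) (u : option 'I_(fun_arity f) -> M) : Om :=
  eqv (fun_int (fun i => u (Some i))) (u None).

Lemma app_eqv_congr (f : fun_sym S) (u v : option 'I_(fun_arity f) -> M) p :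
  (forall o, p <= eqv (u o) (v o)) -> p <= app_eqv u -> p <= app_eqv v.
Proof.
move=> puv pu; apply: le_eqv_trans (le_eqv_trans pu (puv None)).
by apply: le_eqv_sym; exact: fun_int_congr.
Qed.

Lemma le_app_eqP (f : fun_sym S) (Y : Type)
    (us : option 'I_(fun_arity f) -> term S Y) (b : Y -> M) p :
  p <= form_val (app_eq L us) b <->
  [/\ p <= textent b, forall o, below_term p (us o) &
      p <= app_eqv (fun o => term_val (us o) b)].
Proof.
rewrite le_EqP; split=> [[pb pus pu pv]|[pb pus pv]]; split=> //.
  by case=> [i|] // c ic; apply: pus; exists i.
by move=> c [i]; exact: pus.
Qed.

Lemma Eq_sym_val (X : Type) (t s : term S X) (a : X -> M) :
  form_val (Eq (L := L) t s) a = form_val (Eq (L := L) s t) a.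
Proof.
by apply: eq_by_le => p; rewrite !le_EqP; split=> -[pa pt ps pv]; split=> //;
  exact: le_eqv_sym.
Qed.

Lemma le_eq_appP (f : fun_sym S) (Y : Type)
    (us : option 'I_(fun_arity f) -> term S Y) (b : Y -> M) p :
  p <= form_val (eq_app L us) b <->
  [/\ p <= textent b, forall o, below_term p (us o) &
      p <= app_eqv (fun o => term_val (us o) b)].
Proof. by rewrite Eq_sym_val; exact: le_app_eqP. Qed.

(** Induction on [t] with [Y], [r] and [x] general, since the arguments are unnested in a larger
    context. The entry at [None] is a variable, so only proper subterms need the induction
    hypothesis. *)
Lemma unnest_var_val (X Y : Type) (r : X -> Y) (x : Y) (t : term S X)
    (b : Y -> M) :
  form_val (unnest_var L r x t) b =
  form_val (Eq (L := L) (Var x) (rename_term r t)) b.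
Proof.
elim: t Y r x b => [y|c|f ts IH] Y r x b //=.
rewrite (unnest_args_val (@app_eqv_congr f) (@le_eq_appP f)) //.
by case=> [i|] z a //= _; rewrite IH rename_term_comp.
Qed.

Lemma unnest_eq_val (X : Type) (t s : term S X) (a : X -> M) :
  form_val (unnest_eq L t s) a = form_val (Eq (L := L) t s) a.
Proof.
have appE f (ts : option 'I_(fun_arity f) -> term S X) :
    form_val (unnest_args (ts := ts) (app_eq L (f := f))
      (fun o z => unnest_var L (@old X _) z (ts o))) a =
    form_val (app_eq L ts) a.
  rewrite (unnest_args_val (@app_eqv_congr f) (@le_app_eqP f)) // => *.
  exact: unnest_var_val.
have eq_appE f (ts : option 'I_(fun_arity f) -> term S X) :
    form_val (unnest_args (ts := ts) (eq_app L (f := f))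
      (fun o z => unnest_var L (@old X _) z (ts o))) a =
    form_val (eq_app L ts) a.
  rewrite (unnest_args_val (@app_eqv_congr f) (@le_eq_appP f)) // => *.
  exact: unnest_var_val.
case: t s => [x|c|f ts] [y|e|g us] //; try exact: appE; try exact: eq_appE.
(* Only the equation between two constants remains. *)
apply/eqP; rewrite eq_le; apply/andP; split.
  apply: exists_form_val_le => b; set p := form_val _ _.
  have /le_ConjP[pba pphi] := lexx p.
  have /le_EqP[_ _ pc pvc] := pphi true.
  have /le_EqP[_ _ pe pve] := pphi false.
  have pa : p <= textent a.
    by apply/le_textentP => x; exact: (textent_le (inr x) pba).
  apply/le_EqP; split=> //.
  (* The bound variable links the two constants inside the quantifier. *)
  apply: (le_eqv_trans (term_val_cat (t := Cst c) pba pc)).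
  apply: (le_eqv_trans (le_eqv_sym pvc)).
  exact: le_eqv_trans pve (le_eqv_sym (term_val_cat (t := Cst e) pba pe)).
set p := form_val _ _; have /le_EqP[pa pc pe pv] := lexx p.
(* The value of [c] is the witness; on [p] it also equals that of [e]. *)
pose b (_ : unit) := term_val (Cst c) a.
have pba : p <= textent (tuple_cat b a).
  apply/le_textentP => -[u|x]; first exact: le_term_extent.
  exact: (textent_le x pa).
apply: le_trans (le_exists_form_val _ _ b a).
apply/le_ConjP; split=> // -[]; apply/le_EqP; split=> //.
  exact: (term_val_cat (t := Cst c) pba pc).
exact: le_eqv_trans pv (term_val_cat (t := Cst e) pba pe).
Qed.

Lemma unnest_rel_val (X : Type) (R : rel_sym S)
    (ts : 'I_(rel_arity R) -> term S X) (a : X -> M) :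
  form_val (unnest_rel L ts) a = form_val (Rel (L := L) R ts) a.
Proof.
rewrite (unnest_args_val (fun u v p => @rel_int_congr _ _ _ M R u v p)
  (fun Y => @le_RelP _ _ _ M L Y R)) //.
by move=> *; exact: unnest_var_val.
Qed.

End Unnest.

Theorem corollary7p7 (d : Order.disp_t) (Om : cHeytingType d)
    (S : signature Om) (L : language) (M : structure S)
    (X : Type) (hX : context_ok L X) (psi : form S L X) (a : X -> M) :
  form_val psi a = form_val (unnest psi) a.
Proof.
(* Every clause of the interpretation is met with the extent of the formula, so each case of a
   connective or quantifier needs this besides the induction hypothesis. *)
have extE Y (phi : form S L Y) : form_extent (unnest phi) = form_extent phi.
  by rewrite /form_extent unnest_consts.
(* The tuple stays general because under a quantifier the hypothesis is applied to [tuple_cat b a]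
   in the context [V + X]. *)
elim: psi a {hX} => {X} [X t s|X R ts|X phi IH|X phi IHphi psi IHpsi|
    X I ok phis IH|X I ok phis IH|X V ok phi IH|X V ok phi IH] a.
- by rewrite unnest_eq_val.
- by rewrite unnest_rel_val.
- by have := extE _ (Neg phi) => /= ->; rewrite IH.
- by have := extE _ (Imp phi psi) => /= ->; rewrite IHphi IHpsi.
- have := extE _ (Conj I ok phis) => /= ->.
  by under [in LHS]eq_fun do rewrite IH.
- have := extE _ (Disj I ok phis) => /= ->.
  by under [in LHS]eq_fun do rewrite IH.
- have := extE _ (Exi V ok phi) => /= ->.
  by under [in LHS]eq_fun do rewrite IH.
- have := extE _ (All V ok phi) => /= ->.
  by under [in LHS]eq_fun do rewrite IH.
Qed.
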